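(* Let $G_2$ be the graph with vertex set $\{u_1,\dots,u_5,v_1,\dots,v_{10}\}$ whose edges are the five edges of the cycle $u_1u_2u_3u_4u_5u_1$, the ten edges of the cycle $v_1v_2v_3v_4v_5v_6v_7v_8v_9v_{10}v_1$, and the six edges $u_1v_1$, $u_2v_3$, $u_3v_5$, $u_4v_7$, $u_5v_9$, $v_4v_8$. Then $G_2$ is subcubic, planar, and has girth $5$, and $G_2$ has no $(1,2^4)$-packing edge-coloring.
   Context: A graph is subcubic if its maximum degree is at most $3$. The girth of a graph is the length of a shortest cycle. For distinct edges $e,f$ of $G$, the distance between $e$ and $f$ is the distance between the corresponding vertices of the line graph $L(G)$ (so edges sharing an endpoint are at distance $1$). A $(1,2^4)$-packing edge-coloring of $G$ is a partition of $E(G)$ into five classes (possibly empty) such that in the first class any two distinct edges are at distance at least $2$ (the class is a matching), and in each of the remaining four classes any two distinct edges are at distance at least $3$ (the class is an induced matching). *)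

(* Defs.v *)
From HB Require Import structures.
From mathcomp Require Import all_boot all_order all_algebra.
From mathcomp Require Import all_classical all_reals all_analysis.
From mathcomp Require Import finset.
Import Order.TTheory GRing.Theory Num.Theory.
Import numFieldNormedType.Exports.

Set Implicit Arguments.
Unset Strict Implicit.
Unset Printing Implicit Defensive.

Record sgraph := SGraph {
  vertex :> finType;
  adj : rel vertex;
  adj_sym : symmetric adj;
  adj_irrefl : irreflexive adj }.

(** Infimum of a set of natural numbers, [None] standing for infinity. *)
Definition inf_nat (P : pred nat) : option nat :=
  if pselect (exists n, P n) is left exP then Some (ex_minn exP) else None.

Definition geq_inf (d : option nat) (k : nat) : bool :=
  if d is Some n then k <= n else true.

Definition neighbors (G : sgraph) (x : G) : {set G} := [set y | adj x y].

Definition max_degree (G : sgraph) : nat := \max_(x : G) #|neighbors x|.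

Definition subcubic (G : sgraph) : bool := max_degree G <= 3.

(** [None] when there is no walk from [x] to [y]. *)
Definition dist (G : sgraph) (x y : G) : option nat :=
  inf_nat (fun n =>
    [exists p : n.-tuple G, path (@adj G) x p && (last x p == y)]).

(** The bound [2 < n] excludes the closed walks [x, y, x], which [ucycleb]
    accepts; the girth of a forest is [None]. *)
Definition girth (G : sgraph) : option nat :=
  inf_nat (fun n =>
    (2 < n) && [exists c : n.-tuple G, ucycleb (@adj G) c]).

Definition edges (G : sgraph) : {set {set G}} :=
  [set [set xy.1; xy.2] | xy : G * G & adj xy.1 xy.2].

Section LineGraph.
Variable G : sgraph.

Definition edge : finType := {e : {set G} | e \in edges G}.

Definition edge_adj : rel edge :=
  fun e f => (e != f) && (val e :&: val f != set0).

Fact edge_adj_sym : symmetric edge_adj.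
Proof. by move=> e f; rewrite /edge_adj eq_sym setIC. Qed.

Fact edge_adj_irrefl : irreflexive edge_adj.
Proof. by move=> e; rewrite /edge_adj eqxx. Qed.

Definition line_graph : sgraph := SGraph edge_adj_sym edge_adj_irrefl.

End LineGraph.

(** The classes may be empty; class [ord0] is the matching, the other four are
    the induced matchings. *)
Definition packing_edge_coloring_1_2222 (G : sgraph)
    (C : 'I_5 -> {set line_graph G}) : Prop :=
  [/\ \bigcup_(i < 5) C i = [set: line_graph G],
      forall i j : 'I_5, i != j -> [disjoint C i & C j],
      {in C ord0 &, forall e f, e != f -> geq_inf (dist e f) 2} &
      forall i : 'I_5, i != ord0 ->
        {in C i &, forall e f, e != f -> geq_inf (dist e f) 3}].

(** A drawing in the plane: vertices are distinct points, the edge [e] is the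
    arc [arc e] (parametrized by the unit interval) joining its two ends, and
    the interior of an arc contains no vertex and no point of another arc. *)
Definition planar (R : realType) (G : sgraph) : Prop :=
  exists (pt : G -> R * R) (arc : edge G -> R -> R * R),
  [/\ injective pt,
      forall e : edge G, exists x y : G,
        [/\ val e = [set x; y], arc e 0%R = pt x & arc e 1%R = pt y],
      forall e, {within `[0%R, 1%R], continuous (arc e)}%classic /\
        {in `[0%R, 1%R]%R &, injective (arc e)},
      forall e x, {in `]0%R, 1%R[%R, forall t, arc e t <> pt x} &
      forall e f, e != f ->
        {in `]0%R, 1%R[%R &, forall s t, arc e s <> arc f t}].

Section G2.

(** [inl i] is u_(i+1) and [inr j] is v_(j+1): thus u_(i+1) is joined to
    v_(2i+1), and the chord v_4 v_8 joins [inr 3] to [inr 7]. *)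
Definition G2_arc (x y : 'I_5 + 'I_10) : bool :=
  match x, y with
  | inl i, inl j => j == i.+1 %% 5 :> nat
  | inr i, inr j =>
      (j == i.+1 %% 10 :> nat) || ((i == 3 :> nat) && (j == 7 :> nat))
  | inl i, inr j => j == i.*2 :> nat
  | inr _, inl _ => false
  end.

Definition G2_adj : rel ('I_5 + 'I_10) :=
  fun x y => G2_arc x y || G2_arc y x.

Fact G2_adj_sym : symmetric G2_adj.
Proof. by move=> x y; rewrite /G2_adj orbC. Qed.

Fact G2_adj_irrefl : irreflexive G2_adj.
Proof. by case=> [[i ltin]|[i ltin]]; move: i ltin; do 11?case=> //. Qed.

Definition G2 : sgraph := SGraph G2_adj_sym G2_adj_irrefl.

End G2.

(* Main.v *)
(** Planarity is witnessed by a straight-line drawing with integer coordinates,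
    where two segments do not meet as soon as the ends of one lie on the same
    side of the line through the other, so that the signs of finitely many
    integer determinants decide the question. Edges [xy] and [zw] that touch,
    or that are joined by an edge of the graph, are at distance at most 2 in the
    line graph; a packing coloring therefore solves the finite constraint
    problem that forbids these conflicts, and exhaustive backtracking finds no
    solution. *)
Require Import Defs.
From HB Require Import structures.
From mathcomp Require Import all_boot all_order all_algebra.
From mathcomp Require Import all_classical all_reals all_analysis.
From mathcomp Require Import finset.
From mathcomp Require Import ring.
Import Order.TTheory GRing.Theory Num.Theory.
Import numFieldNormedType.Exports.

Set Implicit Arguments.
Unset Strict Implicit.
Unset Printing Implicit Defensive.

(** * Infima of sets of naturals and bounds on distance *)

Lemma inf_nat_eq (P : pred nat) n :
  P n -> (forall m, m < n -> ~~ P m) -> inf_nat P = Some n.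
Proof.
move=> Pn ltP; rewrite /inf_nat; case: pselect => [exP|[]]; last by exists n.
case: ex_minnP => m Pm minm; congr Some; apply/eqP.
by rewrite eqn_leq minm //= leqNgt; apply: contraL Pm => /ltP.
Qed.

Lemma geq_inf_dist (G : sgraph) (x y : G) k p :
  geq_inf (dist x y) k -> path (@adj G) x p -> last x p = y -> k <= size p.
Proof.
move=> + pxp lastp; rewrite /dist /inf_nat.
have Pp : [exists q : (size p).-tuple G, path (@adj G) x q && (last x q == y)].
  by apply/existsP; exists (in_tuple p); rewrite pxp lastp eqxx.
case: pselect => [exP|[]]; last by exists (size p).
by case: ex_minnP => m _ minm /= /leq_trans; apply; apply: minm.
Qed.

(** * Colorings as finite constraint problems *)

Section Conflicts.
Variable G : sgraph.
Implicit Types p q : G * G.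

Definition edge_of p : {set G} := [set p.1; p.2].

Definition same_ends p q := (p == q) || (p == (q.2, q.1)).

Definition touching p q :=
  [|| p.1 == q.1, p.1 == q.2, p.2 == q.1 | p.2 == q.2].

Definition close p q :=
  [|| touching p q, adj p.1 q.1, adj p.1 q.2, adj p.2 q.1 | adj p.2 q.2].

(** Two distinct edges are at distance 1 in the line graph when they touch, and at distance at most
    2 when they are close. Pairs are ordered, so both orientations of one edge have to be
    exempted. *)
Definition conflict (induced : bool) p q :=
  ~~ same_ends p q && (if induced then close p q else touching p q).

Definition proper (col : G * G -> nat) (s : seq (G * G)) :=
  {in s &, forall p q, col p = col q -> ~~ conflict (col p != 0) p q}.

(** The row [r] records, for each edge already colored, its conflict with the new edge in the
    matching sense and in the induced sense; [cs] lists the colors of those edges in the same order,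
    latest first. *)
Definition admissible (r : seq (bool * bool)) (cs : seq nat) (c : nat) :=
  all (fun bd => (bd.2 == c) ==> ~~ (if c == 0 then bd.1.1 else bd.1.2))
    (zip r cs).

(* The nested [if] rather than [&&] keeps call-by-value evaluation from
   exploring inadmissible branches. *)
Fixpoint extendable (rows : seq (seq (bool * bool))) (cs : seq nat) : bool :=
  if rows is r :: rows' then
    has (fun c => if admissible r cs c then extendable rows' (c :: cs)
                  else false) (iota 0 5)
  else true.

Fixpoint conflict_rows (prev s : seq (G * G)) : seq (seq (bool * bool)) :=
  if s is e :: s' then
    [seq (conflict false e f, conflict true e f) | f <- prev]
      :: conflict_rows (e :: prev) s'
  else [::].

(** The search succeeds because it may follow [col] itself: at each edge [e] the color [col e] is
    among those tried and passes the test. A failed search thus excludes every proper coloring. *)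
Lemma proper_extendable col prev s :
  (forall p, col p < 5) -> proper col (s ++ prev) ->
  extendable (conflict_rows prev s) (map col prev).
Proof.
move=> col5; elim: s prev => [|e s IHs] prev //; rewrite cat_cons => prop.
have adm : admissible [seq (conflict false e f, conflict true e f) | f <- prev]
             (map col prev) (col e).
  rewrite /admissible zip_map all_map; apply/allP => f fprev /=.
  apply/implyP => /eqP cef.
  have /(_ _) := prop e f _ _ (esym cef).
  rewrite mem_head inE mem_cat fprev !orbT => /(_ isT isT).
  by case: eqP.
have ext : extendable (conflict_rows (e :: prev) s) (map col (e :: prev)).
  apply: IHs => p q pin qin; apply: prop.
    by move: pin; rewrite !(inE, mem_cat) => /or3P[] ->; rewrite ?orbT.
  by move: qin; rewrite !(inE, mem_cat) => /or3P[] ->; rewrite ?orbT.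
apply/hasP; exists (col e); first by rewrite mem_iota col5.
by rewrite adm.
Qed.

Lemma edge_of_edges p : adj p.1 p.2 -> edge_of p \in edges G.
Proof. by move=> adjp; apply/imsetP; exists p; rewrite ?inE. Qed.

Lemma edge_of_inj p q : edge_of p = edge_of q -> p.1 != p.2 -> same_ends p q.
Proof.
case: p q => [x y] [z w] eqE /= neq; rewrite /same_ends !xpair_eqE.
have: y \in edge_of (z, w) by rewrite -eqE set22.
have: x \in edge_of (z, w) by rewrite -eqE set21.
by rewrite !inE => /orP[] /eqP ex /orP[] /eqP ey; move: neq;
  rewrite ex ey !eqxx ?orbT.
Qed.

Lemma adj_neq (x y : G) : adj x y -> x != y.
Proof. by apply: contraTneq => ->; rewrite adj_irrefl. Qed.

Lemma edge_adj_touching (e f : line_graph G) p q :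
  val e = edge_of p -> val f = edge_of q -> e != f -> touching p q -> adj e f.
Proof.
move=> ep fq nef tpq; rewrite /= /edge_adj nef /= ep fq; apply/finset.set0Pn.
by case/or4P: tpq => /eqP eqpq; [exists p.1|exists p.1|exists p.2|exists p.2];
  rewrite !inE eqpq !eqxx ?orbT.
Qed.

Lemma close_sub p q : close p q ->
  touching p q \/ exists r, [/\ adj r.1 r.2, touching p r & touching r q].
Proof.
case/orP; first by left.
by move=> /or4P[] adjpq; right;
  [exists (p.1, q.1)|exists (p.1, q.2)|exists (p.2, q.1)|exists (p.2, q.2)];
  rewrite /touching /= !eqxx ?orbT.
Qed.

Lemma close_path (e f : line_graph G) p q :
  val e = edge_of p -> val f = edge_of q -> e != f -> close p q ->
  exists s, [/\ path (@adj (line_graph G)) e s, last e s = f & size s <= 2].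
Proof.
move=> ep fq nef /close_sub cl.
have step : adj e f ->
    exists s, [/\ path (@adj (line_graph G)) e s, last e s = f & size s <= 2].
  by move=> adjef; exists [:: f]; split=> //; apply/andP.
case: cl => [tpq|[r [adjr tpr trq]]].
  by apply: step; apply: edge_adj_touching tpq.
pose g : line_graph G := exist _ (edge_of r) (edge_of_edges adjr).
have gr : val g = edge_of r by [].
(* The joining edge may be [e] or [f] itself; then [e] and [f] already touch. *)
have [eg|neg] := eqVneq e g.
  by apply: step; apply: edge_adj_touching trq; rewrite // eg.
have [gf|ngf] := eqVneq g f.
  by apply: step; apply: edge_adj_touching tpr; rewrite // -gf.
exists [:: g; f]; split=> //; apply/and3P; split=> //.
  exact: edge_adj_touching tpr.
exact: edge_adj_touching trq.
Qed.

Lemma packing_proper (C : 'I_5 -> {set line_graph G}) (s : seq (G * G)) :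
  packing_edge_coloring_1_2222 C -> {in s, forall p, adj p.1 p.2} ->
  exists2 col, forall p, col p < 5 & proper col s.
Proof.
case=> cover _ matching induced adjs.
have colE (e : line_graph G) : exists i, e \in C i.
  have : e \in \bigcup_(i < 5) C i by rewrite cover inE.
  by case/bigcupP => i _; exists i.
pose colE' e := xchoose (colE e).
(* The default 0 is for pairs that span no edge; none of these occurs in [s]. *)
pose col p : nat :=
  if [pick e : edge G | val e == edge_of p] is Some e then colE' e else 0.
have colP p : p \in s -> exists2 e, val e = edge_of p & col p = colE' e.
  move=> ps; rewrite /col; case: pickP => [e /eqP ep|none]; first by exists e.
  pose e : edge G := exist _ (edge_of p) (edge_of_edges (adjs p ps)).
  by have := none e; rewrite /= eqxx.
exists col => [p|p q ps qs]; first by rewrite /col; case: pickP.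
have [[e ep cp] [f fq cq]] := (colP p ps, colP q qs).
rewrite cp cq => /val_inj eqc.
have eC : e \in C (colE' e) by exact: (xchooseP (colE e)).
have fC : f \in C (colE' e) by rewrite eqc; exact: (xchooseP (colE f)).
apply/negP => /andP[nsame cpq].
have nef : e != f.
  apply: contraNneq nsame => eqef; apply: edge_of_inj.
    by rewrite -ep eqef.
  exact/adj_neq/adjs.
move: cpq; have [c0|cN0] := eqVneq (colE' e) ord0; rewrite ?c0 /=.
  rewrite c0 in eC fC => tpq.
  have adjef := edge_adj_touching ep fq nef tpq.
  have pathf : path (@adj (line_graph G)) e [:: f] by apply/andP.
  by have := geq_inf_dist (matching _ _ eC fC nef) pathf erefl.
rewrite (_ : (colE' e != 0 :> nat) = true) // => cpq.
have [t [pt lt st]] := close_path ep fq nef cpq.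
have := geq_inf_dist (induced _ cN0 _ _ eC fC nef) pt lt.
by rewrite ltnNge st.
Qed.

Lemma no_packing_coloring (s : seq (G * G)) :
  all (fun p => adj p.1 p.2) s -> ~~ extendable (conflict_rows [::] s) [::] ->
  ~ exists C : 'I_5 -> {set line_graph G}, packing_edge_coloring_1_2222 C.
Proof.
move=> /allP adjs /negP next [C packC]; apply: next.
have [col col5 prop] := packing_proper packC adjs.
by apply: (@proper_extendable col [::]) => //; rewrite cats0.
Qed.

End Conflicts.

(** * Straight-line drawings *)

Section StraightLine.
Local Open Scope ring_scope.

(** Twice the signed area of the triangle [a b c]: its sign tells the side of the line [a b] on
    which [c] lies. *)
Definition orient (R : comPzRingType) (a b c : R * R) : R :=
  (b.1 - a.1) * (c.2 - a.2) - (b.2 - a.2) * (c.1 - a.1).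

Definition segment (R : comPzRingType) (a b : R * R) (t : R) : R * R :=
  ((1 - t) * a.1 + t * b.1, (1 - t) * a.2 + t * b.2).

Definition intpt (R : pzRingType) (a : int * int) : R * R :=
  (a.1%:~R, a.2%:~R).

Lemma orient_intpt (R : comPzRingType) a b c :
  orient (intpt R a) (intpt R b) (intpt R c) = (orient a b c)%:~R.
Proof. by rewrite /orient /= !(rmorphB, rmorphM). Qed.

Lemma orient_segment (R : comPzRingType) (a b c d : R * R) t :
  orient a b (segment c d t) = (1 - t) * orient a b c + t * orient a b d.
Proof. by rewrite /orient /segment /=; ring. Qed.

Lemma orient_segment_id (R : comPzRingType) (a b : R * R) t :
  orient a b (segment a b t) = 0.
Proof. by rewrite /orient /segment /=; ring. Qed.

Lemma segment_inj (R : idomainType) (a b : R * R) :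
  a != b -> injective (segment a b).
Proof.
case: a b => [a1 a2] [b1 b2] neq s t [] /= eq1 eq2.
have d1 : (s - t) * (b1 - a1) = 0.
  have -> : (s - t) * (b1 - a1) =
    ((1 - s) * a1 + s * b1) - ((1 - t) * a1 + t * b1) by ring.
  by rewrite eq1 subrr.
have d2 : (s - t) * (b2 - a2) = 0.
  have -> : (s - t) * (b2 - a2) =
    ((1 - s) * a2 + s * b2) - ((1 - t) * a2 + t * b2) by ring.
  by rewrite eq2 subrr.
apply/eqP; rewrite -subr_eq0; apply: contraNT neq => st.
move/eqP: d1; move/eqP: d2; rewrite !mulf_eq0 (negbTE st) /= !subr_eq0.
by move=> /eqP-> /eqP->.
Qed.

Lemma segment0 (R : comPzRingType) (a b : R * R) : segment a b 0 = a.
Proof. by case: a => a1 a2; rewrite /segment subr0 !mul1r !mul0r !addr0. Qed.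

Lemma segment1 (R : comPzRingType) (a b : R * R) : segment a b 1 = b.
Proof. by case: b => b1 b2; rewrite /segment subrr !mul1r !mul0r !add0r. Qed.

Lemma continuous_segment (R : realType) (a b : R * R) :
  continuous (segment a b : R -> R * R).
Proof.
have cont_affine (x y : R) : continuous (fun t : R => (1 - t) * x + t * y).
  move=> t; apply: cvgD; apply: cvgM; [|exact: cvg_cst| |exact: cvg_cst].
    by apply: cvgB; [exact: cvg_cst | exact: cvg_id].
  exact: cvg_id.
by move=> t; exact: (cvg_pair (cont_affine a.1 b.1 t) (cont_affine a.2 b.2 t)).
Qed.

(* A strict convex combination of two numbers of weakly the same sign vanishes
   only if both do. *)
Lemma convex_neq0 (R : realDomainType) (t x y : R) :
  0 < t < 1 -> 0 <= x * y -> (x != 0) || (y != 0) -> (1 - t) * x + t * y != 0.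
Proof.
move=> /andP[t0 t1] xy nz.
have s0 : 0 < 1 - t by rewrite subr_gt0.
apply/negP => /eqP eq0.
(* Multiplying the vanishing combination by [x] makes both terms nonnegative. *)
have : (1 - t) * x ^+ 2 + t * (x * y) = 0.
  by rewrite -(mul0r x) -eq0; ring.
have le_sx : 0 <= (1 - t) * x ^+ 2 by rewrite mulr_ge0 ?sqr_ge0 ?ltW.
have le_txy : 0 <= t * (x * y) by apply: mulr_ge0 => //; apply: ltW.
move/eqP; rewrite paddr_eq0 // mulf_eq0 (gt_eqF s0) /= sqrf_eq0 => /andP[/eqP x0 _].
move: eq0 nz; rewrite x0 mulr0 add0r eqxx /= => /eqP.
by rewrite mulf_eq0 (gt_eqF t0) /= => ->.
Qed.

(** On the line [a b] the orientation vanishes, while along the open segment [c d] it is a strict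
    convex combination of two values of weakly the same sign, not both zero. *)
Lemma segment_off_line (R : realDomainType) (a b c d : int * int) (s t : R) :
  0 < t < 1 -> 0 <= orient a b c * orient a b d ->
  (orient a b c != 0) || (orient a b d != 0) ->
  segment (intpt R a) (intpt R b) s <> segment (intpt R c) (intpt R d) t.
Proof.
move=> t01 ge0 nz /(congr1 (orient (intpt R a) (intpt R b)))/esym/eqP.
rewrite orient_segment_id orient_segment !orient_intpt.
by apply/negP/convex_neq0 => //; rewrite ?intr_eq0 // -rmorphM ler0z.
Qed.

(** The weak inequalities let two edges with a common end pass the test, since that end gives a zero
    orientation. *)
Lemma planar_straight_line (R : realType) (G : sgraph) (pos : G -> int * int) :
  injective pos ->
  (forall x y z, adj x y -> z != x -> z != y ->
    orient (pos x) (pos y) (pos z) != 0) ->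
  (forall x y z w, adj x y -> adj z w ->
    (0 <= orient (pos x) (pos y) (pos z) * orient (pos x) (pos y) (pos w)) ||
    (0 <= orient (pos z) (pos w) (pos x) * orient (pos z) (pos w) (pos y))) ->
  planar R G.
Proof.
move=> pos_inj general cross.
have ends (e : edge G) : {xy : G * G | adj xy.1 xy.2 & val e = edge_of xy}.
  by apply: cid2; case/imsetP: (valP e) => xy; rewrite inE => ? ?; exists xy.
pose en e := s2val (ends e).
have enA e : adj (en e).1 (en e).2 := s2valP (ends e).
have enV e : val e = edge_of (en e) := s2valP' (ends e).
pose pt x := intpt R (pos x).
have pt_inj : injective pt.
  move=> x y [] /intr_inj eq1 /intr_inj eq2; apply: pos_inj.
  by case: (pos x) (pos y) eq1 eq2 => ? ? [? ?] /= -> ->.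
pose arc e := segment (pt (en e).1) (pt (en e).2).
have arc_inj e : injective (arc e).
  by apply: segment_inj; rewrite (inj_eq pt_inj) adj_neq.
exists pt, arc; split => //.
- by move=> e; exists (en e).1, (en e).2; rewrite /arc segment0 segment1.
- move=> e; split; last by move=> s t _ _; apply: arc_inj.
  by apply: continuous_subspaceT => t; apply: continuous_segment.
- move=> e x t; rewrite in_itv /= => /andP[t0 t1] arct.
  have [x1|x1] := eqVneq x (en e).1.
    have : t = 0 by apply: (arc_inj e); rewrite arct x1 /arc segment0.
    by move=> tE; rewrite tE ltxx in t0.
  have [x2|x2] := eqVneq x (en e).2.
    have : t = 1 by apply: (arc_inj e); rewrite arct x2 /arc segment1.
    by move=> tE; rewrite tE ltxx in t1.
  have := general _ _ _ (enA e) x1 x2.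
  rewrite -(@intr_eq0 R) -orient_intpt -[intpt R (pos x)]arct.
  by rewrite orient_segment_id eqxx.
move=> e f nef s t; rewrite !in_itv /= => s01 t01.
pose o (e' : edge G) z := orient (pos (en e').1) (pos (en e').2) (pos z).
(* If both ends of [f'] were on the line of [e'], the general position hypothesis would make them
   ends of [e'], and the two edges would coincide. *)
have off (e' f' : edge G) : e' != f' ->
    (o e' (en f').1 != 0) || (o e' (en f').2 != 0).
  move=> nef'; rewrite -negb_and; apply: contraNN nef' => /andP[z1 z2].
  have in_e z : o e' z == 0 -> z \in val e'.
    rewrite enV !inE; apply: contraTT; rewrite negb_or => /andP[].
    exact: general.
  rewrite eq_sym -val_eqE /= eqEcard; apply/andP; split.
    rewrite [val f']enV; apply/fintype.subsetP => z; rewrite !inE.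
    by move=> /orP[] /eqP ->; apply: in_e.
  by rewrite [val e']enV [val f']enV !cards2 !adj_neq.
have [ge0|ge0] := orP (cross _ _ _ _ (enA e) (enA f)).
  by apply: segment_off_line => //; apply: off.
by move/esym; apply: segment_off_line => //; apply: off; rewrite eq_sym.
Qed.

End StraightLine.

(** * The graph [G2] *)

(* Indices are taken modulo the length of the cycle only to get closed terms
   of ordinal type that compute. *)
Definition u_ k : G2 := inl (Ordinal (ltn_pmod k (isT : 0 < 5))).
Definition v_ k : G2 := inr (Ordinal (ltn_pmod k (isT : 0 < 10))).

(** An explicit list, so that statements quantified over the vertices are decided by evaluation. *)
Definition G2_vertices : seq G2 := map u_ (iota 0 5) ++ map v_ (iota 0 10).

Lemma mem_G2_vertices x : x \in G2_vertices.
Proof.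
by case: x => [[i ltin]|[i ltin]]; move: i ltin; do 11?case=> //.
Qed.

Lemma G2_forall (P : pred G2) : all P G2_vertices -> forall x, P x.
Proof. by move=> /allP allP x; apply/allP/mem_G2_vertices. Qed.

Definition G2_neighbors (x : G2) := [seq y <- G2_vertices | adj x y].

Lemma mem_G2_neighbors x y : (y \in G2_neighbors x) = adj x y.
Proof. by rewrite mem_filter mem_G2_vertices andbT. Qed.

(** Walks with [n] steps, listed without their starting vertex [x], as in [path]. *)
Fixpoint G2_walks n (x : G2) : seq (seq G2) :=
  if n is n'.+1 then
    flatten [seq map (cons y) (G2_walks n' y) | y <- G2_neighbors x]
  else [:: [::]].

Lemma mem_G2_walks x p : path (@adj G2) x p -> p \in G2_walks (size p) x.
Proof.
elim: p x => [|y p IHp] x //= /andP[adjxy pathp]; apply/flatten_mapP.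
by exists y; rewrite ?mem_G2_neighbors // map_f ?IHp.
Qed.

Lemma subcubic_G2 : subcubic G2.
Proof.
apply/bigmax_leqP => x _; apply: (@leq_trans (size (G2_neighbors x))).
  apply: leq_trans (card_size _); apply/subset_leq_card/fintype.subsetP => y.
  by rewrite inE mem_G2_neighbors.
by move: x; apply: G2_forall; vm_compute.
Qed.

Lemma girth_G2 : girth G2 = Some 5.
Proof.
apply: inf_nat_eq => [|m ltm5].
  apply/existsP; exists [tuple u_ 0; u_ 1; u_ 2; u_ 3; u_ 4].
  by vm_compute.
apply/negP => /andP[m_gt2] /existsP[[[|x p] /= /eqP szp] /andP[cyc uniqp]].
  by rewrite -szp in m_gt2.
(* A cycle of length 3 or 4 is a vertex followed by a walk of 2 or 3 steps. *)
have no_cycle : all (fun x => all (fun p => ~~ ucycleb (@adj G2) (x :: p))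
    (G2_walks 2 x ++ G2_walks 3 x)) G2_vertices by vm_compute.
have pathp : path (@adj G2) x p by move: cyc; rewrite /= rcons_path => /andP[].
have : p \in G2_walks 2 x ++ G2_walks 3 x.
  rewrite mem_cat; have := mem_G2_walks pathp.
  by case: szp m_gt2 ltm5 => <-; case: (size p) => [|[|[|[|k]]]] // _ _ ->;
    rewrite ?orbT.
move/allP: (G2_forall no_cycle x) => /[apply] /negP; apply.
by apply/andP; split.
Qed.

(* The faces v_4 v_5 v_6 v_7 v_8 and v_4 v_8 v_9 v_10 v_1 v_2 v_3 share the
   chord; the latter is the unbounded one here. *)
Definition G2_pos (x : G2) : int * int :=
  match x with
  | inl i => nth (0, 0) [:: (-1, -1); (2, -1); (3, 1); (1, 1); (0, 2)] i
  | inr i => nth (0, 0) [:: (-5, -4); (2, -8); (7, -3); (6, 2); (5, 3);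
                            (3, 4); (2, 5); (4, 7); (-2, 7); (-7, 0)] i
  end%R.

Lemma planar_G2 (R : realType) : planar R G2.
Proof.
apply: (@planar_straight_line R G2 G2_pos).
- move=> x y eqxy; apply/eqP; move: eqxy => /eqP; apply/implyP; move: y.
  by apply: G2_forall; move: x; apply: G2_forall; vm_compute.
- move=> x y z; rewrite -mem_G2_neighbors => adjxy zx zy.
  (* The hypotheses are folded into a boolean test over explicit lists, ready for evaluation. *)
  suff: all (fun y => all (fun z => [|| z == x, z == y |
      orient (G2_pos x) (G2_pos y) (G2_pos z) != 0%R]) G2_vertices)
      (G2_neighbors x).
    by move=> /allP/(_ _ adjxy)/G2_forall/(_ z); rewrite (negbTE zx) (negbTE zy).
  by move: {adjxy zx zy} x; apply: G2_forall; vm_compute.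
move=> x y z w; rewrite -!mem_G2_neighbors => adjxy adjzw.
pose o a b c := orient (G2_pos a) (G2_pos b) (G2_pos c).
suff: all (fun y => all (fun z => all (fun w =>
    (0 <= o x y z * o x y w)%R || (0 <= o z w x * o z w y)%R)
    (G2_neighbors z)) G2_vertices) (G2_neighbors x).
  by move=> /allP/(_ _ adjxy)/G2_forall/(_ z)/allP/(_ _ adjzw).
by move: {adjxy adjzw} x; apply: G2_forall; vm_compute.
Qed.

(* All 21 edges, in an order found by local search to keep the backtracking
   tree small (about 6000 nodes). *)
Definition G2_edges : seq (G2 * G2) :=
  [:: (u_ 2, u_ 3); (u_ 2, v_ 4); (u_ 1, u_ 2); (u_ 3, v_ 6); (u_ 3, u_ 4);
      (v_ 5, v_ 6); (v_ 4, v_ 5); (v_ 6, v_ 7); (v_ 3, v_ 4); (v_ 3, v_ 7);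
      (v_ 7, v_ 8); (u_ 4, v_ 8); (v_ 2, v_ 3); (u_ 1, v_ 2); (u_ 0, u_ 1);
      (u_ 4, u_ 0); (v_ 0, v_ 1); (v_ 9, v_ 0); (u_ 0, v_ 0); (v_ 8, v_ 9);
      (v_ 1, v_ 2)].

Lemma no_packing_G2 : ~ exists C : 'I_5 -> {set line_graph G2},
  packing_edge_coloring_1_2222 C.
Proof. by apply: (@no_packing_coloring G2 G2_edges); vm_compute. Qed.

Theorem mainTheorem6 (R : realType) :
  [/\ subcubic G2, planar R G2, girth G2 = Some 5 &
      ~ exists C : 'I_5 -> {set line_graph G2},
          packing_edge_coloring_1_2222 C].
Proof.
split; [exact: subcubic_G2 | exact: planar_G2 | exact: girth_G2 |].
exact: no_packing_G2.
Qed.
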